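(* Let $L>0$, let $f:\mathbb{R}^d\to\mathbb{R}$ belong to $\mathcal{F}_{0,L}$ with $f_*:=\inf_x f(x)>-\infty$, let $N\ge 1$ be an integer, and let $x_{i+1}=x_i-\gamma\nabla f(x_i)$, $i=0,\dots,N-1$, be $N$ iterations of gradient descent started from $x_0\in\mathbb{R}^d$ with constant stepsize $\gamma$ satisfying $\gamma L\in(0,2)$. Then $$\frac{1}{2L}\|\nabla f(x_N)\|^2\le \frac{f(x_0)-f_*}{1+\gamma L\,\min\Big\{2N,\ \frac{-1+(1-\gamma L)^{-2N}}{\gamma L}\Big\}}.$$
   Context: For $L\in(0,\infty)$ and $\mu\in(-\infty,L)$, $\mathcal{F}_{\mu,L}$ is the class of functions $f:\mathbb{R}^d\to\mathbb{R}$ such that both $\frac{L}{2}\|\cdot\|^2-f$ and $f-\frac{\mu}{2}\|\cdot\|^2$ are convex, where $\|\cdot\|$ is the Euclidean norm (such functions are differentiable). When $\gamma L=1$, the quantity $(1-\gamma L)^{-2N}$ is read as $+\infty$, so the minimum equals its other argument. *)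

(* Defs.v *)
From mathcomp Require Import all_boot all_order all_algebra.
From mathcomp Require Import boolp classical_sets reals constructive_ereal ereal.
From mathcomp Require Import topology normedtype derive convex.

Set Implicit Arguments.
Unset Strict Implicit.
Unset Printing Implicit Defensive.

Import Order.TTheory GRing.Theory Num.Theory.
Import numFieldNormedType.Exports.

Local Open Scope classical_set_scope.
Local Open Scope ring_scope.

(* The library norm `|v| on 'rV[R]_d is the sup norm, hence the explicit
   Euclidean norm.  Both norms induce the same topology, so derivatives may be
   taken with respect to the library structure. *)
Definition enorm (R : realType) (d : nat) (v : 'rV[R]_d) : R :=
  Num.sqrt (\sum_(i < d) v 0 i ^+ 2).

(* 'D_v f x is a total operator with an unspecified value where f has no
   derivative along v; at a point of differentiability this row of partial
   derivatives is the gradient. *)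
Definition grad (R : realType) (d : nat) (f : 'rV[R]_d -> R) (x : 'rV[R]_d) :
    'rV[R]_d :=
  \row_(j < d) 'D_(delta_mx 0 j) (f : 'rV[R]_d -> R^o) x.

(* Differentiability is not assumed: for mu < L it follows from the two
   convexity conditions. *)
Definition Fclass (R : realType) (d : nat) (mu L : R) : set ('rV[R]_d -> R) :=
  [set f | @convex_function R 'rV[R]_d setT
             (fun x => L / 2 * enorm x ^+ 2 - f x)
         /\ @convex_function R 'rV[R]_d setT
             (fun x => f x - mu / 2 * enorm x ^+ 2)].
Arguments Fclass {R} d mu L.

Definition finf (R : realType) (d : nat) (f : 'rV[R]_d -> R) : \bar R :=
  ereal_inf (range (fun x => (f x)%:E)).

(* Main.v *)
Require Import Defs.
From mathcomp Require Import all_boot all_order all_algebra.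
From mathcomp Require Import boolp classical_sets reals constructive_ereal ereal.
From mathcomp Require Import topology normedtype derive convex.
From mathcomp Require Import interval_inference ring lra.

Import Order.TTheory GRing.Theory Num.Theory.
Import numFieldNormedType.Exports.

Local Open Scope classical_set_scope.
Local Open Scope ring_scope.

(** Rescale so that the smoothness constant is 1: put h = gamma * L and
    r = h - 1, which lies in ]-1, 1[, and replace f by L f and x by L x; then
    one step is x' = x - (1 + r) g with g the gradient at x.  The two values
    competing in the minimum come from two extremal functions.  On the quadratic
    |x|^2 / 2 successive gradients satisfy g' = - r g, and the squared gradient
    decays like r^(2N); on a Huber function whose iterates stay in the affine
    part all gradients are equal, and the decrease of f is N h |g|^2.

    A convex 1-smooth function satisfies, for any two points a and b, the
    interpolation inequality
      f a >= f b + <g_b, a - b> + |g_a - g_b|^2 / 2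
    (lemma interpolation).  The rate is a nonnegative combination of these
    inequalities between iterates at distance one and two; distance one alone
    is in general not enough once h > 3/2.  The combination is organised as an
    induction: after n steps there is a weight t >= 0 with
      f_0 - f_n >= (1 - r) t G + (n h - h^2 t) |g_n|^2 + t |g_n + r g_(n-1)|^2,
    where G >= 0 is the slack of the interpolation inequality from x_(n-1) to
    x_n (lemmas potential_step and potential_iter).  The square vanishes on the
    quadratic, while on the Huber function it restores exactly the h^2 t |g_n|^2
    that was subtracted: there the bound is sharp for every t, which leaves t
    free to be adjusted to the quadratic.

    The next weight t' is dictated by the requirement that no multiple of
    |g_n - g_(n+1)|^2 remains, an affine recurrence t' = (2 t + c_n) / (2 r^2)
    whose solution satisfies 1 + 2 n h - 2 h^2 t = r^(-2n).  As long as the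
    recurrence stays nonnegative the bound on f_0 - f_n is thus the one of the
    quadratic.  Once it would turn negative, the weight 0 is admissible, it
    remains admissible forever, and the bound is the one of the Huber function.
    Adding f_N - f_* >= |g_N|^2 / 2 gives, in either case, one of the two
    rates, hence the weaker of them, which is the claim.

    The gradient is a row of partial derivatives of a function that is not
    assumed differentiable.  Convexity makes one-sided directional derivatives
    exist and be subadditive; convexity of L/2 |.|^2 - f makes them
    superadditive as well, so they are linear and given by the gradient. *)

(** * Euclidean inner product *)

Section DotProduct.
Context {R : realType} {d : nat}.
Implicit Types (u v w : 'rV[R]_d) (a : R).

Definition dot u v : R := \sum_(i < d) u 0 i * v 0 i.

Lemma dotC u v : dot u v = dot v u.
Proof. by apply: eq_bigr => i _; rewrite mulrC. Qed.

Lemma dotDl u v w : dot (u + v) w = dot u w + dot v w.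
Proof. by rewrite -big_split; apply: eq_bigr => i _; rewrite mxE mulrDl. Qed.

Lemma dotZl a u v : dot (a *: u) v = a * dot u v.
Proof. by rewrite mulr_sumr; apply: eq_bigr => i _; rewrite mxE mulrA. Qed.

Lemma dotNl u v : dot (- u) v = - dot u v.
Proof. by rewrite -scaleN1r dotZl mulN1r. Qed.

Lemma dotDr u v w : dot w (u + v) = dot w u + dot w v.
Proof. by rewrite dotC dotDl !(dotC _ w). Qed.

Lemma dotZr a u v : dot u (a *: v) = a * dot u v.
Proof. by rewrite dotC dotZl dotC. Qed.

Lemma dotNr u v : dot u (- v) = - dot u v.
Proof. by rewrite dotC dotNl dotC. Qed.

Lemma dot_ge0 u : 0 <= dot u u.
Proof. by apply: sumr_ge0 => i _; rewrite -expr2 sqr_ge0. Qed.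

Lemma enorm_sq u : enorm u ^+ 2 = dot u u.
Proof.
rewrite /enorm sqr_sqrtr; last by apply: sumr_ge0 => i _; rewrite sqr_ge0.
by apply: eq_bigr => i _; rewrite expr2.
Qed.

Definition dotE := (dotDl, dotDr, dotNl, dotNr, dotZl, dotZr).

(** Slack of the interpolation inequality of a 1-smooth convex function between
    points a and b, with values Fa, Fb, gradients ga, gb and displacement
    s = a - b. *)
Definition gap (Fa Fb : R) (ga gb s : 'rV[R]_d) : R :=
  Fa - Fb - dot gb s - dot (ga - gb) (ga - gb) / 2.

End DotProduct.

(** * Gradients of smooth convex functions *)

Lemma ler_small_slack {R : realType} (a b c : R) :
  (forall t, 0 < t -> a <= b + t * c) -> a <= b.
Proof.
move=> H; have [//|ba] := leP a b.
have c1_gt0 : 0 < `|c| + 1 by rewrite ltr_pwDr.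
have := H ((a - b) / (`|c| + 1) / 2).
have cc : c <= `|c| := ler_norm c.
have e : (a - b) / (`|c| + 1) * (`|c| + 1) = a - b by rewrite divfK ?gt_eqF.
have : 0 < (a - b) / (`|c| + 1) by rewrite divr_gt0 ?subr_gt0.
by move: ((a - b) / _) e => q e q0 /(_ ltac:(lra)); nra.
Qed.

Section SmoothConvex.
Context {R : realType} {d : nat} (L : R) (f : 'rV[R]_d -> R).
Hypothesis L_gt0 : 0 < L.
Hypothesis f_class : Fclass d 0 L f.
Implicit Types (x y u v w : 'rV[R]_d) (a s t : R).

Lemma Fclass_conv_le t x y : 0 <= t <= 1 ->
  f (t *: x + (1 - t) *: y) <= t * f x + (1 - t) * f y.
Proof.
move=> t01; have [_ cvx] := f_class.
have := cvx (Itv01 (andP t01).1 (andP t01).2) x y (in_setT _) (in_setT _).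
by rewrite !mul0r !subr0.
Qed.

(** Convexity of L/2 |.|^2 - f, using that for z = t x + (1 - t) y the number
    t |x|^2 + (1 - t) |y|^2 - |z|^2 is t (1 - t) |x - y|^2. *)
Lemma Fclass_conv_ge t x y : 0 <= t <= 1 ->
  t * f x + (1 - t) * f y - L / 2 * (t * (1 - t)) * dot (x - y) (x - y)
  <= f (t *: x + (1 - t) *: y).
Proof.
move=> t01; have [cvx _] := f_class.
have : L / 2 * enorm (t *: x + (1 - t) *: y) ^+ 2 - f (t *: x + (1 - t) *: y)
    <= t * (L / 2 * enorm x ^+ 2 - f x) + (1 - t) * (L / 2 * enorm y ^+ 2 - f y).
  exact: cvx (Itv01 (andP t01).1 (andP t01).2) x y (in_setT _) (in_setT _).
rewrite !enorm_sq !dotE !(dotC y x) -subr_ge0 => H; rewrite -subr_ge0.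
by apply: le_trans H _; rewrite le_eqVlt; apply/orP; left; apply/eqP; field.
Qed.

(** The one-sided derivative at x along v: for convex f the slopes increase with
    t, so their infimum over t > 0 is their limit at 0+. *)
Definition dirder x v : R :=
  inf [set (f (x + t *: v) - f x) / t | t in [set t | 0 < t]].

(** x is a convex combination of x + t v and x - v. *)
Lemma slope_lb x v t : 0 < t -> f x - f (x - v) <= (f (x + t *: v) - f x) / t.
Proof.
move=> t_gt0; rewrite ler_pdivlMr//.
have t1_gt0 : 0 < 1 + t by lra.
have := Fclass_conv_le (1 + t)^-1 (x + t *: v) (x - v).
rewrite invr_ge0 (ltW t1_gt0) invf_le1// lerDl (ltW t_gt0) => /(_ isT).
have -> : 1 - (1 + t)^-1 = t * (1 + t)^-1 by field; lra.
have -> : (1 + t)^-1 *: (x + t *: v) + (t * (1 + t)^-1) *: (x - v) = x.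
  rewrite !scalerDr addrACA -scalerDl scalerN scalerA (mulrC t) subrr addr0.
  by rewrite -[X in X + _]mulr1 -mulrDr mulVf ?scale1r// gt_eqF.
rewrite -subr_ge0 -(pmulr_rge0 _ t1_gt0) => H; rewrite -subr_ge0.
by apply: le_trans H _; rewrite le_eqVlt; apply/orP; left; apply/eqP; field; lra.
Qed.

Lemma has_lbound_slope x v :
  has_lbound [set (f (x + t *: v) - f x) / t | t in [set t | 0 < t]].
Proof. by exists (f x - f (x - v)) => _ [t t0 <-]; exact: slope_lb. Qed.

Lemma dirder_lb x v t : 0 < t -> f x + t * dirder x v <= f (x + t *: v).
Proof.
move=> t0; rewrite -lerBrDl mulrC -ler_pdivlMr//.
by apply: ge_inf; [exact: has_lbound_slope|exists t].
Qed.

(** Every slope at s > 0 exceeds the slope at t up to L/2 t |v|^2: for s <= t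
    the semi-concavity estimate bounds f from below on the segment from x to
    x + t v, and for t < s slopes are monotone by convexity. *)
Lemma dirder_ub x v t : 0 < t ->
  f (x + t *: v) <= f x + t * dirder x v + L / 2 * t ^+ 2 * dot v v.
Proof.
move=> t0.
suff H : (f (x + t *: v) - f x) / t - L / 2 * t * dot v v <= dirder x v.
  move: H; rewrite -(ler_pM2l t0) mulrBr mulrC divfK ?gt_eqF//.
  by move: (f _) (dirder _ _) => A B; nra.
apply: lb_le_inf.
  by exists ((f (x + t *: v) - f x) / t), t.
move=> _ [s /= s0 <-]; set q := dot v v.
have q0 : 0 <= q := dot_ge0 v.
have Ltq : 0 <= L / 2 * t * q by rewrite mulr_ge0// mulr_ge0 ?ltW// divr_gt0.
have convE a z : a *: (x + z) + (1 - a) *: x = x + a *: z.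
  by rewrite scalerDr addrAC -scalerDl addrCA subrr addr0 scale1r.
set Ds := _ / s; set Dt := _ / t.
have fs : f (x + s *: v) = f x + s * Ds by rewrite mulrC divfK ?gt_eqF// subrKC.
have ft : f (x + t *: v) = f x + t * Dt by rewrite mulrC divfK ?gt_eqF// subrKC.
have [st|ts] := leP s t.
  have a01 : 0 <= s / t <= 1.
    by rewrite (divr_ge0 (ltW s0) (ltW t0)) ler_pdivrMr// mul1r.
  have := @Fclass_conv_ge (s / t) (x + t *: v) x a01.
  have -> : x + t *: v - x = t *: v by rewrite addrAC subrr add0r.
  rewrite convE scalerA divfK ?gt_eqF// fs ft.
  rewrite dotZl dotZr -/q; move: a01; set a := s / t => a01.
  have sE : s = a * t by rewrite /a divfK ?gt_eqF.
  have aLtq : 0 <= a * (L / 2 * t * q) by rewrite mulr_ge0//; case/andP: a01.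
  rewrite sE => H; rewrite -(ler_pM2l s0) sE; clear - H aLtq a01 t0 Ltq.
  have := mulr_ge0 (ltW t0) (mulr_ge0 (andP a01).1 aLtq). lra.
have a01 : 0 <= t / s <= 1.
  by rewrite (divr_ge0 (ltW t0) (ltW s0)) ler_pdivrMr// mul1r ltW.
have := @Fclass_conv_le (t / s) (x + s *: v) x a01.
rewrite convE scalerA divfK ?gt_eqF// fs ft.
have -> : t / s * (f x + s * Ds) + (1 - t / s) * f x = f x + t * Ds.
  by field; rewrite gt_eqF.
by rewrite lerD2l ler_pM2l//; lra.
Qed.

(** x + t (u + v) is the midpoint of x + 2t u and x + 2t v.  Convexity at this
    midpoint gives subadditivity, the quadratic lower bound gives
    superadditivity, both with an O(t^2) error that is negligible against the
    factor t in front of the derivatives. *)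
Lemma dirderD x u v : dirder x (u + v) = dirder x u + dirder x v.
Proof.
pose C w := L / 2 * dot w w.
have mid t : x + t *: (u + v) =
    (1 / 2) *: (x + (2 * t) *: u) + (1 - 1 / 2) *: (x + (2 * t) *: v).
  have -> : 1 - 1 / 2 = 1 / 2 :> R by lra.
  rewrite -scalerDr addrACA -scalerDr -mulr2n -[x *+ 2]scaler_nat [RHS]scalerDr !scalerA.
  have -> : 1 / 2 * 2 = 1 :> R by lra.
  by have -> : 1 / 2 * (2 * t) = t by [lra]; rewrite scale1r.
have half01 : 0 <= (1 / 2 : R) <= 1 by apply/andP; split; lra.
apply/eqP; rewrite eq_le; apply/andP; split.
  apply: (@ler_small_slack _ _ _ (2 * (C u + C v))) => t t0.
  have t20 : 0 < 2 * t by lra.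
  have := @Fclass_conv_le _ (x + (2 * t) *: u) (x + (2 * t) *: v) half01.
  rewrite -mid; move: (dirder_lb x (u + v) _ t0).
  move: (dirder_ub x u _ t20) (dirder_ub x v _ t20).
  rewrite /C => Hu Hv Huv Hm.
  rewrite -(ler_pM2l t0); nra.
apply: (@ler_small_slack _ _ _ (C (u + v) + C (u - v))) => t t0.
have t20 : 0 < 2 * t by lra.
have := @Fclass_conv_ge _ (x + (2 * t) *: u) (x + (2 * t) *: v) half01.
rewrite -mid; move: (dirder_ub x (u + v) _ t0).
move: (dirder_lb x u _ t20) (dirder_lb x v _ t20).
have -> : x + (2 * t) *: u - (x + (2 * t) *: v) = (2 * t) *: (u - v).
  by rewrite opprD addrACA subrr add0r scalerBr.
rewrite dotZl dotZr /C => Huv Hu Hv Hm.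
rewrite -(ler_pM2l t0); nra.
Qed.

Lemma dirder0 x : dirder x 0 = 0.
Proof. by apply: (addrI (dirder x 0)); rewrite -dirderD !addr0. Qed.

Lemma dirderN x v : dirder x (- v) = - dirder x v.
Proof. by apply: (addrI (dirder x v)); rewrite -dirderD !subrr dirder0. Qed.

Lemma dirderZ x a v : dirder x (a *: v) = a * dirder x v.
Proof.
wlog a_gt0 : a / 0 < a.
  move=> H; have [a0|a0|->] := ltgtP a 0; last by rewrite scale0r dirder0 mul0r.
    by rewrite -[in LHS](opprK a) scaleNr dirderN H ?oppr_gt0// mulNr opprK.
  exact: H.
apply/eqP; rewrite eq_le; apply/andP; split.
  apply: (@ler_small_slack _ _ _ (L / 2 * a ^+ 2 * dot v v)) => t t0.
  have := dirder_lb x (a *: v) _ t0; have := dirder_ub x v _ (mulr_gt0 t0 a_gt0).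
  rewrite scalerA => H1 H2; rewrite -(ler_pM2l t0); have := le_trans H2 H1; nra.
apply: (@ler_small_slack _ _ _ (L / 2 * a ^+ 2 * dot v v)) => t t0.
have := dirder_ub x (a *: v) _ t0; have := dirder_lb x v _ (mulr_gt0 t0 a_gt0).
rewrite scalerA dotZl dotZr => H1 H2; rewrite -(ler_pM2l t0).
have := le_trans H1 H2; nra.
Qed.

Lemma dirder_itv x v t : f x + t * dirder x v <= f (x + t *: v) <=
  f x + t * dirder x v + L / 2 * t ^+ 2 * dot v v.
Proof.
have [t0|t0|->] := ltgtP t 0.
- have nt_gt0 : 0 < - t by rewrite oppr_gt0.
  have := dirder_lb x (- v) _ nt_gt0; have := dirder_ub x (- v) _ nt_gt0.
  have -> : - t *: - v = t *: v by rewrite scalerN scaleNr opprK.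
  have -> : dot (- v) (- v) = dot v v by rewrite dotNl dotNr opprK.
  by rewrite dirderN mulrNN sqrrN => -> ->.
- by rewrite dirder_lb// dirder_ub.
- by rewrite scale0r addr0 expr0n/= mulr0 !mul0r !addr0 lexx.
Qed.

(** The error in dirder_itv is quadratic in t and holds for both signs of t, so
    the two-sided difference quotient converges. *)
Lemma gradE x : grad f x = \row_j dirder x (delta_mx 0 j).
Proof.
apply/rowP => j; rewrite !mxE; apply: cvg_lim => //.
set e := delta_mx 0 j; set p := dirder x e.
pose C := L / 2 * dot e e.
have C_ge0 : 0 <= C by rewrite mulr_ge0 ?dot_ge0// divr_ge0 ?ltW.
apply/cvgrPdist_le => eps eps_gt0.
have C1_gt0 : 0 < C + 1 by rewrite ltr_wpDl.
near=> h.
have h_neq0 : h != 0 by near: h; exact: nbhs_dnbhs_neq.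
have h_small : `|h| < eps / (C + 1).
  by near: h; apply: dnbhs0_lt; rewrite divr_gt0.
have /andP[lo hi] := dirder_itv x e h.
rewrite /= [h *: e + x]addrC.
have -> : p - h^-1 *: (f (x + h *: e) - f x : R^o) =
    - (f (x + h *: e) - f x - h * p) / h.
  by rewrite /GRing.scale/=; field.
rewrite normrM normfV normrN ler_pdivrMr ?normr_gt0// ger0_norm; last first.
  by rewrite -addrA -opprD subr_ge0.
apply: le_trans (_ : C * `|h| ^+ 2 <= _).
  by rewrite real_normK ?num_real// /C; move: hi; rewrite -/p; lra.
rewrite expr2 mulrA ler_pM2r ?normr_gt0//.
apply: le_trans (_ : C * (eps / (C + 1)) <= _); first by rewrite ler_wpM2l// ltW.
rewrite mulrCA ger_pMr// ler_pdivrMr// mul1r; lra.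
Unshelve. all: by end_near. Qed.

Lemma dirderE x v : dirder x v = dot (grad f x) v.
Proof.
rewrite {1}[v]row_sum_delta (big_morph _ (dirderD x) (dirder0 x)).
by apply: eq_bigr => j _; rewrite gradE mxE dirderZ mulrC.
Qed.

Lemma grad_lower x y : f x + dot (grad f x) (y - x) <= f y.
Proof.
have /andP[+ _] := dirder_itv x (y - x) 1.
by rewrite scale1r mul1r subrKC dirderE.
Qed.

Lemma grad_upper x y :
  f y <= f x + dot (grad f x) (y - x) + L / 2 * dot (y - x) (y - x).
Proof.
have /andP[_] := dirder_itv x (y - x) 1.
by rewrite scale1r mul1r subrKC dirderE expr1n mulr1.
Qed.

(** The quadratic upper bound at x is minimised by this point. *)
Lemma grad_descent x :
  f (x - L^-1 *: grad f x) <= f x - dot (grad f x) (grad f x) / (2 * L).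
Proof.
apply: le_trans (grad_upper x _) _.
rewrite (_ : x - _ - x = - (L^-1 *: grad f x)) ?dotE; last first.
  by rewrite addrAC subrr add0r.
by rewrite le_eqVlt; apply/orP; left; apply/eqP; field; rewrite gt_eqF.
Qed.

(** Compare the affine minorant at y with the quadratic majorant at x, at the
    point z where their difference is largest. *)
Lemma interpolation x y :
  f y + dot (grad f y) (x - y)
    + dot (grad f x - grad f y) (grad f x - grad f y) / (2 * L) <= f x.
Proof.
pose z := x - L^-1 *: (grad f x - grad f y).
apply: le_trans (_ : f y + dot (grad f y) (z - y) - dot (grad f x) (z - x)
  - L / 2 * dot (z - x) (z - x) <= _); last first.
  by have := le_trans (grad_lower y z) (grad_upper x z); lra.
rewrite le_eqVlt; apply/orP; left; apply/eqP.
by rewrite /z !dotE (dotC (grad f x) (grad f y)); field; rewrite gt_eqF.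
Qed.

Lemma gap_grad_ge0 x y :
  0 <= gap (L * f x) (L * f y) (grad f x) (grad f y) (L *: (x - y)).
Proof.
have := interpolation x y; rewrite /gap dotZr -(ler_pM2l L_gt0).
set n := dot (grad f x - _) _ => H; rewrite -subr_ge0 in H.
apply: le_trans H _; rewrite le_eqVlt; apply/orP; left; apply/eqP.
by field; rewrite gt_eqF.
Qed.

End SmoothConvex.

(** * The potential along gradient descent *)

Section Certificate.
Context {R : realType} {d : nat}.
Implicit Types (u v w : 'rV[R]_d) (r t : R).

(** Slack in the induction hypothesis after m steps: u and v are the last two
    gradients, and t is the weight that interpolates between the rate of Huber
    functions (t = 0) and the rate of the quadratic (t as large as the
    recurrence in potential_iter allows). *)
Definition potential r (F0 Fu Fv m t : R) u v : R :=
  F0 - Fv - (1 - r) * t * gap Fu Fv u v ((1 + r) *: u)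
  - (m * (1 + r) - (1 + r) ^+ 2 * t) * dot v v
  - t * dot (v + r *: u) (v + r *: u).

(** Three consecutive gradients u, v, w.  The new slack is the old one plus the
    interpolation inequalities between the last two points and between the
    points of u and w, in both directions.  Weights t and r t at distance two
    cancel every term in u left by the hypothesis; the weights at distance one
    then follow from balancing function values and the coefficients of |v|^2
    and |w|^2.  What remains is a multiple of
    |v - w|^2, whose sign is the last hypothesis. *)
Lemma potential_step r (F0 Fu Fv Fw m t t' : R) u v w :
  0 <= potential r F0 Fu Fv m t u v ->
  0 <= t * gap Fu Fw u w ((1 + r) *: (u + v)) ->
  0 <= r * t * gap Fw Fu w u (- ((1 + r) *: (u + v))) ->
  0 <= gap Fv Fw v w ((1 + r) *: v) ->
  0 <= gap Fw Fv w v (- ((1 + r) *: v)) ->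
  0 <= 2 * m + 2 - (1 + r) * t' - 2 * t ->
  0 <= 2 * m + 1 - 2 * r * t' - (1 + r) * t ->
  2 * t + (2 * m + 2) * r - (2 * m + 1) <= 2 * r ^+ 2 * t' ->
  0 <= potential r F0 Fv Fw (m + 1) t' v w.
Proof.
move=> P A2 B2 A B a0 b0; rewrite -subr_ge0 => delta0.
suff -> : potential r F0 Fv Fw (m + 1) t' v w =
    potential r F0 Fu Fv m t u v
    + t * gap Fu Fw u w ((1 + r) *: (u + v))
    + r * t * gap Fw Fu w u (- ((1 + r) *: (u + v)))
    + (2 * m + 2 - (1 + r) * t' - 2 * t) * gap Fv Fw v w ((1 + r) *: v)
    + (2 * m + 1 - 2 * r * t' - (1 + r) * t)
      * gap Fw Fv w v (- ((1 + r) *: v))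
    + (2 * r ^+ 2 * t' - (2 * t + (2 * m + 2) * r - (2 * m + 1)))
      * dot (v - w) (v - w) / 2.
  have K : 0 <= (2 * r ^+ 2 * t' - (2 * t + (2 * m + 2) * r - (2 * m + 1)))
      * dot (v - w) (v - w) / 2 by rewrite !mulr_ge0 ?dot_ge0 ?invr_ge0.
  have Da := mulr_ge0 a0 A; have Db := mulr_ge0 b0 B.
  exact: addr_ge0 (addr_ge0 (addr_ge0 (addr_ge0 (addr_ge0 P A2) B2) Da) Db) K.
rewrite /potential /gap !dotE (dotC v u) (dotC w u) (dotC w v).
by field.
Qed.

Section Iterates.
Context (r : R) (F : nat -> R) (g x : nat -> 'rV[R]_d) (N : nat).
Hypothesis r_itv : -1 < r < 1.
Hypothesis gap_ge0 : forall i j, 0 <= gap (F i) (F j) (g i) (g j) (x i - x j).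
Hypothesis x_step : forall i, (i < N)%N -> x i.+1 = x i - (1 + r) *: g i.

Lemma potential_iter_step n (t t' : R) : (n < N)%N -> (n = 0%N -> t = 0) ->
  0 <= t -> 0 <= r * t ->
  0 <= potential r (F 0%N) (F n.-1) (F n) n%:R t (g n.-1) (g n) ->
  0 <= 2 * n%:R + 2 - (1 + r) * t' - 2 * t ->
  0 <= 2 * n%:R + 1 - 2 * r * t' - (1 + r) * t ->
  2 * t + (2 * n%:R + 2) * r - (2 * n%:R + 1) <= 2 * r ^+ 2 * t' ->
  0 <= potential r (F 0%N) (F n) (F n.+1) n.+1%:R t' (g n) (g n.+1).
Proof.
move=> nN t_eq0 t0 rt0 P a0 b0 delta0; rewrite -[n.+1%:R]natr1.
have fwd : x n - x n.+1 = (1 + r) *: g n by rewrite x_step// subKr.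
have fwd2 k : (k.+1 < N)%N -> x k - x k.+2 = (1 + r) *: (g k + g k.+1).
  move=> kN; rewrite x_step// x_step; last exact: ltnW.
  by rewrite scalerDr !opprD !opprK !addrA subrr add0r.
(* At n = 0 the point before x 0 is fictitious, and has weight t = 0. *)
apply: (@potential_step r _ (F n.-1) _ _ _ t _ (g n.-1)) => //.
- case: n nN t_eq0 {P a0 b0 delta0 fwd} => [|n] nN t_eq0.
    by rewrite t_eq0// mul0r.
  by apply: mulr_ge0 => //; rewrite -fwd2//; exact: gap_ge0.
- case: n nN t_eq0 {P a0 b0 delta0 fwd} => [|n] nN t_eq0.
    by rewrite t_eq0// mulr0 mul0r.
  by apply: mulr_ge0 => //; rewrite -fwd2// opprB; exact: gap_ge0.
- by rewrite -fwd.
- by rewrite -fwd opprB.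
Qed.

(** The two cases of the conclusion are the regimes of the quadratic and of the
    Huber function.  In the former, t follows the recurrence
    2 r^2 t' = 2 t + (2 n + 2) r - (2 n + 1), whose solution obeys the stated
    closed form; the linear bound on t keeps the weights of potential_step
    nonnegative.  In the latter, t = 0 and the inequality on r says that the
    recurrence started at 0 would give t' <= 0; it passes from n to n + 1
    because r <= 1. *)
Lemma potential_iter n : (n <= N)%N -> exists t : R,
  [/\ 0 <= t, 0 <= potential r (F 0%N) (F n.-1) (F n) n%:R t (g n.-1) (g n),
      n = 0%N -> t = 0 &
      [/\ 1 / 2 < r, 2 * r ^+ 2 * t <= n%:R * (2 * r - 1) &
          r ^+ (2 * n) * (1 + 2 * n%:R * (1 + r) - 2 * (1 + r) ^+ 2 * t) = 1]
      \/ t = 0 /\ (2 * n%:R + 2) * r <= 2 * n%:R + 1].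
Proof.
have [r_gtN1 r_lt1] := andP r_itv.
elim: n => [|n IHn] nN.
  exists 0; split => //.
    rewrite /potential /gap; lra.
  have [r_le|r_gt] := leP r (1 / 2); first by right; split => //; lra.
  by left; split; [by []|lra|rewrite expr0; ring].
have [t [t_ge0 Pn t_eq0]] := IHn (ltnW nN).
have := potential_iter_step n t _ nN t_eq0 t_ge0 _ Pn.
have n_ge0 : 0 <= n%:R :> R := ler0n R n.
move: Pn => _ step [[r_gt t_le t_eq]|[t0 r_le]]; last first.
  exists 0; split => //; last first.
    by right; split => //; rewrite -natr1; nra.
  by apply: step; rewrite ?t0; nra.
have r2_gt0 : 0 < 2 * r ^+ 2 by nra.
(* k is the value of t at n = 1.  The bounds on k below show that t <= n k keeps
   the weights of potential_step nonnegative; the first one also shows that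
   t <= n k is inherited by n + 1. *)
pose k := (2 * r - 1) / (2 * r ^+ 2).
have t_lek : t <= n%:R * k by rewrite mulrA ler_pdivlMr// mulrC.
have k_ge0 : 0 <= k by apply: divr_ge0; [lra|exact: ltW].
have k2_le1 : 2 * k <= 1 by rewrite mulrA ler_pdivrMr//; nra.
have kr_le1 : 2 * r * k <= 1 by rewrite mulrA ler_pdivrMr//; nra.
have k1r_le1 : (1 + r) * k <= 1 by rewrite mulrA ler_pdivrMr//; nra.
have [t'_lt0|t'_ge0] := ltP (2 * t + (2 * n%:R + 2) * r - (2 * n%:R + 1)) 0.
  exists 0; split => //; last first.
    by right; split => //; rewrite -natr1; nra.
  by apply: step; nra.
pose t' := (2 * t + (2 * n%:R + 2) * r - (2 * n%:R + 1)) / (2 * r ^+ 2).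
have t'E : 2 * r ^+ 2 * t' = 2 * t + (2 * n%:R + 2) * r - (2 * n%:R + 1).
  by rewrite mulrC divfK// gt_eqF.
have t'_le : 2 * r ^+ 2 * t' <= (n%:R + 1) * (2 * r - 1) by rewrite t'E; nra.
have t'_lek : t' <= (n%:R + 1) * k by rewrite mulrA ler_pdivlMr// mulrC.
exists t'; split => //.
- by rewrite divr_ge0// ltW.
- by apply: step; rewrite ?t'E; nra.
- left; split; [by []|by rewrite -[n.+1%:R]natr1|].
  have r_neq0 : r != 0 by rewrite gt_eqF//; lra.
  rewrite -[RHS]t_eq mulnS exprD -[n.+1%:R]natr1 mulrAC mulrC.
  congr (_ * _); transitivity (r ^+ 2 + 2 * (n%:R + 1) * (1 + r) * r ^+ 2
                   - (1 + r) ^+ 2 * (2 * r ^+ 2 * t')); first by ring.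
  by rewrite t'E; ring.
Qed.

(** Adding |g_N|^2 / 2 <= F N - Fstar to the bound on F 0 - F N supplies the
    summand 1 of both rates. *)
Lemma final_gradient_bound (Fstar : R) :
  dot (g N) (g N) / 2 <= F N - Fstar ->
  (1 + 2 * N%:R * (1 + r)) * dot (g N) (g N) <= 2 * (F 0%N - Fstar) \/
  0 < r /\ (r ^+ (2 * N))^-1 * dot (g N) (g N) <= 2 * (F 0%N - Fstar).
Proof.
move=> tail; have [t [t_ge0 P t_eq0 t_cases]] := potential_iter N (leqnn N).
have [r_gtN1 r_lt1] := andP r_itv.
have Q_ge0 := dot_ge0 (g N).
have grow : (1 + 2 * N%:R * (1 + r) - 2 * (1 + r) ^+ 2 * t) * dot (g N) (g N)
    <= 2 * (F 0%N - Fstar).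
  have S_ge0 := mulr_ge0 t_ge0 (dot_ge0 (g N + r *: g N.-1)).
  have A_ge0 : 0 <= t * gap (F N.-1) (F N) (g N.-1) (g N) ((1 + r) *: g N.-1).
    case: N x_step t_eq0 {P t_cases Q_ge0 tail S_ge0} => [|n] xS t0.
      by rewrite t0// mul0r.
    by apply: mulr_ge0 => //; move: (gap_ge0 n n.+1); rewrite xS// subKr.
  have r1_ge0 : 0 <= 1 - r by lra.
  have {}A_ge0 := mulr_ge0 r1_ge0 A_ge0.
  move: P A_ge0 S_ge0 tail; rewrite /potential subr_ge0.
  move: (gap _ _ _ _ _) (dot _ _) (dot (g N) _) => G S E; nra.
case: t_cases => [[r_gt _ t_eq]|[t0 _]]; last first.
  by left; move: grow; rewrite t0 mulr0 subr0.
right; split; first lra.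
suff -> : (r ^+ (2 * N))^-1 = 1 + 2 * N%:R * (1 + r) - 2 * (1 + r) ^+ 2 * t by [].
have rN_neq0 : r ^+ (2 * N) != 0 by rewrite expf_neq0// gt_eqF//; lra.
by apply: (mulfI rN_neq0); rewrite t_eq mulfV.
Qed.

End Iterates.

End Certificate.

(** * The rate in extended real numbers *)

(** The minimum commutes with y |-> 1 + h y, which maps (q^-1 - 1) / h to
    q^-1, also for q = 0 where both are +oo. *)
Lemma min_rateE {R : realType} (h q a : R) : 0 < h -> 0 <= q ->
  (1 + h%:E * Order.min a%:E ((-1 + (q%:E)^-1) / h%:E)
   = Order.min (1 + h * a)%:E (q%:E)^-1)%E.
Proof.
move=> h_gt0; rewrite le_eqVlt => /predU1P[<-|q_gt0].
  rewrite inve0 addey// inver gt_eqF// gt0_mulye ?lte_fin ?invr_gt0//.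
  by rewrite !miney.
rewrite !inver !gt_eqF// -EFinN -EFinD -EFinM -!EFin_min -EFinM -EFinD.
congr (_%:E).
have [le|lt] := leP a ((-1 + q^-1) / h); [rewrite min_l//|rewrite min_r].
- by move: le; rewrite ler_pdivlMr//; lra.
- by rewrite mulrC divfK ?gt_eqF//; lra.
- by move: lt; rewrite ltr_pdivrMr//; lra.
Qed.

Lemma le_div_min_rate {R : realType} (h q a Delta e : R) :
  0 < h -> 0 <= q -> 0 <= a -> 0 <= e ->
  (1 + h * a) * e <= Delta \/ 0 < q /\ q^-1 * e <= Delta ->
  (e%:E <= Delta%:E /
     (1 + h%:E * Order.min a%:E ((-1 + (q%:E)^-1) / h%:E)))%E.
Proof.
move=> h_gt0 q_ge0 a_ge0 e_ge0 bound; rewrite min_rateE//.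
have ha_gt0 : 0 < 1 + h * a by rewrite ltr_pwDl// mulr_ge0// ltW.
have {q_ge0} [q0|q_gt0] : q = 0 \/ 0 < q.
  by move: q_ge0; rewrite le_eqVlt => /predU1P[<-|]; [left|right].
  rewrite q0 inve0 miney inver gt_eqF// lee_fin ler_pdivlMr// mulrC.
  by case: bound => [//|[]]; rewrite q0 ltxx.
rewrite inver gt_eqF// -EFin_min inver.
set D := Order.min _ _.
have D_gt0 : 0 < D by rewrite lt_min ha_gt0 invr_gt0.
rewrite gt_eqF// lee_fin ler_pdivlMr// mulrC.
case: bound => [|[_]]; apply: le_trans; apply: ler_wpM2r => //.
  by rewrite ge_min lexx.
by rewrite ge_min lexx orbT.
Qed.

(* In extended reals 0^-1 = +oo, so for gamma * L = 1 the second argument of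
   the minimum is +oo. *)
Theorem theorem2p2 (R : realType) (d : nat) (L gamma : R)
    (f : 'rV[R]_d -> R) (N : nat) (x : nat -> 'rV[R]_d) :
  0 < L ->
  Fclass d 0 L f ->
  (-oo < finf f)%E ->
  (1 <= N)%N ->
  0 < gamma * L < 2 ->
  (forall i : nat, (i < N)%N -> x i.+1 = x i - gamma *: grad f (x i)) ->
  ((1 / (2 * L) * enorm (grad f (x N)) ^+ 2)%:E <=
   ((f (x 0%N))%:E - finf f) /
   (1 + (gamma * L)%:E *
        Order.min (2 * N)%:R%:E
                  ((-1 + (((1 - gamma * L) ^+ (2 * N))%:E)^-1)
                   / (gamma * L)%:E)))%E.
Proof.
move=> L_gt0 f_class finf_gtNy _ /andP[h_gt0 h_lt2] x_step.
have finf_lb y : (finf f <= (f y)%:E)%E by apply: ereal_inf_lbound; exists y.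
have [fs fsE] : exists fs, finf f = fs%:E.
  case: (finf f) finf_gtNy (finf_lb 0) => [fs _ _||]; [by exists fs|by []|by []].
rewrite fsE -EFinB enorm_sq; apply: le_div_min_rate => //.
  by rewrite exprM exprn_ge0// sqr_ge0.
  by rewrite mulr_ge0 ?dot_ge0// divr_ge0// mulr_ge0// ltW.
pose r := gamma * L - 1.
have r_itv : -1 < r < 1 by rewrite /r; apply/andP; split; lra.
have rE : 1 + r = gamma * L by rewrite subrKC.
have Lx_step i : (i < N)%N ->
    L *: x i.+1 = L *: x i - (1 + r) *: grad f (x i).
  by move=> /x_step ->; rewrite rE scalerBr scalerA mulrC.
have gap_x i j : 0 <= gap (L * f (x i)) (L * f (x j)) (grad f (x i))
    (grad f (x j)) (L *: x i - L *: x j).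
  by rewrite -scalerBr; exact: gap_grad_ge0.
have tail : dot (grad f (x N)) (grad f (x N)) / 2 <= L * f (x N) - L * fs.
  have := grad_descent L f L_gt0 f_class (x N).
  have := finf_lb (x N - L^-1 *: grad f (x N)); rewrite fsE lee_fin.
  move=> /le_trans/[apply]; rewrite -(ler_pM2l L_gt0) mulrBr.
  have -> : L * (dot (grad f (x N)) (grad f (x N)) / (2 * L)) =
      dot (grad f (x N)) (grad f (x N)) / 2 by field; rewrite gt_eqF.
  lra.
have scale e : e <= 2 * (L * f (x 0%N) - L * fs) ->
    1 / (2 * L) * e <= f (x 0%N) - fs.
  by rewrite mul1r [_^-1 * _]mulrC ler_pdivrMr ?mulr_gt0// => H; lra.
have [bd|[r_gt0 bd]] := final_gradient_bound r (fun i => L * f (x i))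
    (fun i => grad f (x i)) (fun i => L *: x i) N r_itv gap_x Lx_step _ tail.
  by left; move: (scale _ bd); rewrite rE natrM mulrCA (mulrC (gamma * L)).
right; have -> : (1 - gamma * L) ^+ (2 * N) = r ^+ (2 * N).
  by rewrite !exprM -(sqrrN r) opprB.
by split; [exact: exprn_gt0|move: (scale _ bd); rewrite mulrCA].
Qed.
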